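(* Let $a_0\in L_{0,A}(\mathbf C^d)$, let $a_0^{\mathrm{aw}}\in\widehat A(\mathbf C^{2d})$ be given by $$a_0^{\mathrm{aw}}(z,w)=\pi^{-d}\int_{\mathbf C^d}a_0(w_1)e^{-(z-w_1,w-w_1)}\,d\lambda(w_1),$$ and let $\omega\in\mathscr P_E(\mathbf C^d)$. If $$|a_0(w)|\lesssim\omega(2w),\quad w\in\mathbf C^d,$$ then $$|a_0^{\mathrm{aw}}(z,w)|\lesssim e^{\frac14|z-w|^2}\omega(z+w),\quad z,w\in\mathbf C^d.$$
   Context: $(z,w)=\sum_jz_j\overline{w_j}$, $d\lambda$ is Lebesgue measure on $\mathbf C^d$, $\lesssim$ means inequality up to a constant independent of $z,w$. $L_{0,A}(\mathbf C^d)$ is the set of $a_0\in L^1_{loc}(\mathbf C^d)$ such that $w\mapsto a_0(w)e^{r|w|-|w|^2}\in L^1(\mathbf C^d)$ for every $r>0$. $\widehat A(\mathbf C^{2d})$ is the set of functions $a(z,w)$ such that $(z,w)\mapsto a(z,\overline w)$ is entire on $\mathbf C^{2d}$. The function $a_0^{\mathrm{aw}}$ is the Wick symbol of the anti-Wick operator $F\mapsto\pi^{-d}\int a_0(w)F(w)e^{(\cdot-w,w)}d\lambda(w)$. $\mathscr P_E(\mathbf C^d)$, with $\mathbf C^d\simeq\mathbf R^{2d}$, is the set of all moderate weights, i.e. positive $\omega$ with $\omega,1/\omega\in L^\infty_{loc}$ for which there are a positive locally bounded function $v$ and $C\ge1$ with $\omega(z+w)\le C\omega(z)v(w)$ for all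 $z,w$. *)

(* Defs.v *)
From HB Require Import structures.
From mathcomp Require Import all_boot all_order all_algebra.
From mathcomp Require Import complex.
From mathcomp Require Import all_classical all_reals all_analysis.

Set Implicit Arguments.
Unset Strict Implicit.
Unset Printing Implicit Defensive.

Import Order.TTheory GRing.Theory Num.Theory.
Import numFieldNormedType.Exports.

Local Open Scope classical_set_scope.
Local Open Scope ring_scope.
Local Open Scope complex_scope.

(* The product of two sigma-finite measures, repackaged as a sigma-finite
   measure: the library instance on [m1 \x m2] is shadowed by the one for
   subprobabilities and is not found by inference. *)
Section sigma_finite_product.
Context d1 d2 (T1 : measurableType d1) (T2 : measurableType d2) {R : realType}.
Variable m1 : {sigma_finite_measure set T1 -> \bar R}.
Variable m2 : {sigma_finite_measure set T2 -> \bar R}.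

Definition sf_product : set (T1 * T2) -> \bar R := (m1 \x m2)%E.

HB.instance Definition _ := Measure.copy sf_product (m1 \x m2)%E.

Let sf_product_sigma_finite : sigma_finite setT sf_product.
Proof.
have /sigma_finiteP[F [TF ndF Foo]] := sigma_finiteT m1.
have /sigma_finiteP[G [TG ndG Goo]] := sigma_finiteT m2.
exists (fun n => F n `*` G n).
  rewrite -setXTT TF TG predeqE => -[x y]; split.
    move=> [/= [n _ Fnx] [k _ Gky]]; exists (maxn n k) => //; split.
    - by move: x Fnx; exact/subsetPset/ndF/leq_maxl.
    - by move: y Gky; exact/subsetPset/ndG/leq_maxr.
  by move=> [n _ []/= ? ?]; split; exists n.
move=> k; have [? ?] := Foo k; have [? ?] := Goo k.
split; first exact: measurableX.
by rewrite /sf_product product_measure1E// lte_mul_pinfty// ge0_fin_numE.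
Qed.

HB.instance Definition _ := Measure_isSigmaFinite.Build _ _ _ sf_product
  sf_product_sigma_finite.

End sigma_finite_product.

(* [n.-tuple R] carries the product sigma-algebra of the Borel sets of R. *)
Definition Rn (R : realType) (n : nat) := n.-tuple (measurableTypeR R).

Section lebesgue_step.
Context {R : realType} (n : nat).

Definition consRn (p : (measurableTypeR R * Rn R n)%type) : Rn R n.+1 :=
  [tuple of p.1 :: p.2].

Lemma measurable_consRn : measurable_fun [set: _] consRn.
Proof. exact: measurable_cons. Qed.

Variable m : {sigma_finite_measure set (Rn R n) -> \bar R}.

Definition lebesgue_step : set (Rn R n.+1) -> \bar R :=
  pushforward (sf_product (@lebesgue_measure R) m) consRn.

Let measurable_consRnV A : measurable A -> measurable (consRn @^-1` A).
Proof.
by move=> mA; rewrite -[X in measurable X]setTI; exact: measurable_consRn.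
Qed.

Let step0 : lebesgue_step set0 = 0%E.
Proof. by rewrite /lebesgue_step /pushforward preimage_set0 measure0. Qed.

Let step_ge0 A : (0 <= lebesgue_step A)%E.
Proof. by rewrite /lebesgue_step /pushforward measure_ge0. Qed.

Let step_sigma_additive : semi_sigma_additive lebesgue_step.
Proof.
move=> F mF tF mUF; rewrite /lebesgue_step /pushforward preimage_bigcup.
apply: measure_semi_sigma_additive.
- by move=> k; exact: measurable_consRnV.
- apply/trivIsetP => /= i j _ _ ij; rewrite -preimage_setI.
  by move/trivIsetP : tF => /(_ _ _ _ _ ij) ->//; rewrite preimage_set0.
- by rewrite -preimage_bigcup; exact: measurable_consRnV.
Qed.

HB.instance Definition _ := isMeasure.Build _ _ _ lebesgue_step
  step0 step_ge0 step_sigma_additive.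

Let step_sigma_finite : sigma_finite setT lebesgue_step.
Proof.
have [F TF Foo] := sigma_finiteT (sf_product (@lebesgue_measure R) m).
pose u (t : Rn R n.+1) : (measurableTypeR R * Rn R n)%type :=
  (thead t, [tuple of behead t]).
have uK : cancel consRn u.
  move=> [x t]; rewrite /u /consRn /=; congr pair; last exact: val_inj.
have mu_ : measurable_fun setT u.
  apply: measurable_fun_pair; first exact: measurable_tnth.
  exact: measurable_behead.
exists (fun k => u @^-1` (F k)).
  by rewrite -preimage_bigcup -TF preimage_setT.
move=> k; have [mF Fk] := Foo k; split.
  by rewrite -[X in measurable X]setTI; exact: mu_.
rewrite /lebesgue_step /pushforward -comp_preimage.
by rewrite (_ : u \o consRn = id)//; apply/funext => p; exact: uK.
Qed.

HB.instance Definition _ := Measure_isSigmaFinite.Build _ _ _ lebesgue_step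
  step_sigma_finite.

End lebesgue_step.

(* Lebesgue measure on R^n, as the n-fold product of Lebesgue measure on R. *)
Fixpoint lebesgueRn (R : realType) (n : nat) :
    {sigma_finite_measure set (Rn R n) -> \bar R} :=
  match n with
  | 0 => dirac ([tuple] : Rn R 0)
  | n.+1 => lebesgue_step (lebesgueRn R n)
  end.

(* [^o] only selects R[i] as a normed space over itself, which gives row
   vectors their usual topology and complex linear structure. *)
Notation Cn R d := 'rV[(R[i])^o]_d.

(* The identification R^d x R^d ~ C^d, (x, y) |-> x + iy: integration and
   null sets on C^d are read through it. *)
Definition toCn (R : realType) (d : nat) (p : (Rn R d * Rn R d)%type) : Cn R d :=
  \row_j (tnth p.1 j +i* tnth p.2 j).

Section definitions.
Context {R : realType} {d : nat}.
Implicit Types (z w : Cn R d).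

Definition lambdaC : {sigma_finite_measure set (Rn R d * Rn R d)%type -> \bar R} :=
  sf_product (lebesgueRn R d) (lebesgueRn R d).

(* Measurability for the completed sigma-algebra: almost everywhere equal to
   a Borel function. *)
Definition lebesgue_measurable (f : Cn R d -> R) :=
  exists2 g : (Rn R d * Rn R d)%type -> R, measurable_fun setT g &
    {ae lambdaC, forall p, f (toCn p) = g p}.

Definition Cmeasurable (f : Cn R d -> R[i]) :=
  lebesgue_measurable (fun w => complex.Re (f w)) /\
  lebesgue_measurable (fun w => complex.Im (f w)).

Definition Cabs (x : R[i]) : R := ComplexField.Normc.normc x.

Definition L1C (f : Cn R d -> R[i]) :=
  Cmeasurable f /\ (\int[lambdaC]_p (Cabs (f (toCn p)))%:E < +oo)%E.

Definition L1locC (f : Cn R d -> R[i]) :=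
  Cmeasurable f /\ forall K : set (Cn R d), compact K ->
    (\int[lambdaC]_(p in @toCn R d @^-1` K) (Cabs (f (toCn p)))%:E < +oo)%E.

Definition LinftylocC (f : Cn R d -> R) :=
  lebesgue_measurable f /\ forall K : set (Cn R d), compact K ->
    exists M : R, {ae lambdaC, forall p, K (toCn p) -> `|f (toCn p)| <= M}.

Definition Cintegral (f : Cn R d -> R[i]) : R[i] :=
  (\int[lambdaC]_p complex.Re (f (toCn p)))
    +i* (\int[lambdaC]_p complex.Im (f (toCn p))).

Definition Cexp (x : R[i]) : R[i] :=
  (expR (complex.Re x))%:C * (cos (complex.Im x) +i* sin (complex.Im x)).

Definition dotC z w : R[i] := \sum_j z 0 j * (w 0 j)^*%C.

(* The Euclidean norm; the library norm on matrices is the max norm. *)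
Definition enorm z : R := Num.sqrt (\sum_j Cabs (z 0 j) ^+ 2).

Definition conjCn w : Cn R d := map_mx (@conjc R) w.

Definition L0A (a0 : Cn R d -> R[i]) :=
  L1locC a0 /\ forall r : R, 0 < r ->
    L1C (fun w => a0 w * (expR (r * enorm w - enorm w ^+ 2))%:C).

(* Differentiability is over the scalar field R[i], hence complex. *)
Definition hatA (a : Cn R d -> Cn R d -> R[i]) :=
  forall p : Cn R d * Cn R d,
    differentiable
      (fun q : Cn R d * Cn R d => a q.1 (conjCn q.2) : (R[i])^o) p.

Definition locally_bounded (v : Cn R d -> R) :=
  forall K : set (Cn R d), compact K ->
    exists M : R, forall w, K w -> `|v w| <= M.

Definition moderate_weight (omega : Cn R d -> R) :=
  [/\ forall z, 0 < omega z,
      LinftylocC omega,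
      LinftylocC (fun z => (omega z)^-1) &
      exists (v : Cn R d -> R) (C : R),
        [/\ forall w, 0 < v w, locally_bounded v, 1 <= C &
            forall z w, omega (z + w) <= C * omega z * v w]].

End definitions.

(* Main.v *)
(* Completing the square, Re (z - w1, w - w1) = |w1 - c|^2 - |z - w|^2 / 4 with
   c = (z + w) / 2, so the kernel has modulus e^(|z - w|^2 / 4) times a Gaussian
   centred at c.  Iterating the moderateness inequality over steps in a compact
   set bounds omega (x + y) / omega x by e^(k (1 + |y|_1)), so omega (2 w1) is at
   most omega (z + w) e^(k (1 + 2 |w1 - c|_1)), and half of the exponent of the
   Gaussian absorbs this factor.  What remains integrates, by Tonelli, to a constant that does not
   depend on c. *)
Require Import Defs.
From HB Require Import structures.
From mathcomp Require Import all_boot all_order all_algebra.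
From mathcomp Require Import complex ring lra.
From mathcomp Require Import all_classical all_reals all_analysis.
From mathcomp Require Import measurable_realfun normal_distribution.

Set Implicit Arguments.
Unset Strict Implicit.
Unset Printing Implicit Defensive.

Import Order.TTheory GRing.Theory Num.Theory.
Import numFieldNormedType.Exports HBNNSimple.

Local Open Scope classical_set_scope.
Local Open Scope ring_scope.
Local Open Scope complex_scope.

(** * Integrals dominated almost everywhere *)

Section integral_bounds.
Context d (T : measurableType d) (R : realType).
Variable mu : {measure set T -> \bar R}.

(* [f] need not be measurable: its integral is then the lower integral. *)
Lemma ae_ge0_le_lower_integral (f g : T -> \bar R) :
  (forall x, (0 <= f x)%E) -> (forall x, (0 <= g x)%E) ->
  measurable_fun setT g -> {ae mu, forall x, (f x <= g x)%E} ->
  (\int[mu]_x f x <= \int[mu]_x g x)%E.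
Proof.
move=> f0 g0 mg fg; rewrite ge0_integralTE//.
(* Each simple function [h] below [f] is measurable, so the usual comparison applies to [h] and
   [g]. *)
apply: ge_ereal_sup => _ [h hf <-]; rewrite -integralT_nnsfun.
apply: ae_ge0_le_integral => //.
- by move=> x _; rewrite lee_fin.
- exact/measurable_EFinP.
- by apply: filterS fg => x fgx _; exact: le_trans (hf x) fgx.
Qed.

(** The integrals of the positive and negative parts of [f] both lie in [[0, b]], hence so does the
    absolute value of their difference. *)
Lemma normr_Rintegral_le_dominated (f : T -> R) (g : T -> \bar R) (b : R) :
  (forall x, (0 <= g x)%E) -> measurable_fun setT g ->
  {ae mu, forall x, (`|f x|%:E <= g x)%E} ->
  (\int[mu]_x g x <= b%:E)%E -> `|\int[mu]_x f x| <= b.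
Proof.
move=> g0 mg fg gb; rewrite /Rintegral integralE.
have h (u : T -> \bar R) : (forall x, 0 <= u x)%E ->
    (forall x, u x <= `|f x|%:E)%E ->
    (0 <= \int[mu]_x u x <= b%:E)%E.
  move=> u0 uf; rewrite integral_ge0//=; apply: le_trans gb.
  apply: ae_ge0_le_lower_integral => //.
  by apply: filterS fg => x; exact: le_trans (uf x).
have hp x : (((EFin \o f) ^\+) x <= `|f x|%:E)%E.
  by rewrite funeposE/= -EFin_max lee_fin ge_max ler_norm/=.
have hn x : (((EFin \o f) ^\-) x <= `|f x|%:E)%E.
  by rewrite funenegE/= -EFin_max lee_fin ge_max -normrN ler_norm/=.
move: (h _ (funepos_ge0 _) hp) (h _ (funeneg_ge0 _) hn).
case: (integral _ _ (_ ^\-)%E) => [v||]//; case: (integral _ _ (_ ^\+)%E) => [u||]//;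
  rewrite ?leye_eq/= ?andbF//.
rewrite !lee_fin => /andP[u0 ub] /andP[v0 vb]; rewrite ler_norml; lra.
Qed.

End integral_bounds.

(** * Tonelli for products of one-variable functions, and the Gaussian integral *)

Lemma integral_sf_product_tensor d1 d2 (T1 : measurableType d1)
    (T2 : measurableType d2) (R : realType)
    (m1 : {sigma_finite_measure set T1 -> \bar R})
    (m2 : {sigma_finite_measure set T2 -> \bar R})
    (f : T1 -> R) (g : T2 -> R) (a b : R) :
  (forall x, 0 <= f x) -> (forall y, 0 <= g y) ->
  measurable_fun setT f -> measurable_fun setT g ->
  (\int[m1]_x (f x)%:E = a%:E)%E -> (\int[m2]_y (g y)%:E = b%:E)%E ->
  (\int[sf_product m1 m2]_p (f p.1 * g p.2)%:E = (a * b)%:E)%E.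
Proof.
move=> f0 g0 mf mg fa gb.
rewrite [LHS](_ : _ = (\int[m1 \x m2]_p (f p.1 * g p.2)%:E)%E)//.
rewrite fubini_tonelli1; last 2 first.
- apply/measurable_EFinP; apply: measurable_funM.
    exact: measurableT_comp mf measurable_fst.
  exact: measurableT_comp mg measurable_snd.
- by move=> x; rewrite lee_fin mulr_ge0.
rewrite /fubini_F /=.
under eq_integral => x _.
  under eq_integral do rewrite EFinM.
  rewrite ge0_integralZl//; last 3 first.
  - exact/measurable_EFinP.
  - by move=> y _; rewrite lee_fin.
  - by rewrite lee_fin.
  rewrite gb muleC.
  over.
rewrite ge0_integralZl ?fa -?EFinM 1?mulrC//.
- exact/measurable_EFinP.
- by move=> y _; rewrite lee_fin.
- by rewrite -gb; apply: integral_ge0 => y _; rewrite lee_fin.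
Qed.

Lemma measurable_prod_tnth (R : realType) (n : nat) (g : 'I_n -> R -> R) :
  (forall i, measurable_fun setT (g i)) ->
  measurable_fun setT (fun t : Rn R n => \prod_i g i (tnth t i)).
Proof.
move=> mg; apply: measurable_prod => i _.
by apply: measurableT_comp (mg i) _; exact: measurable_tnth.
Qed.

(** Induction on [n]: the measure in dimension [n.+1] is a pushforward along [consRn], so the factor
    of index 0 splits off. In dimension 0 it is a point mass and the product is empty. *)
Lemma integral_lebesgueRn_prod (R : realType) (n : nat)
    (g : 'I_n -> R -> R) (b : 'I_n -> R) :
  (forall i x, 0 <= g i x) -> (forall i, measurable_fun setT (g i)) ->
  (forall i, \int[@lebesgue_measure R]_x (g i x)%:E = (b i)%:E)%E ->
  (\int[lebesgueRn R n]_t (\prod_i g i (tnth t i))%:E = (\prod_i b i)%:E)%E.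
Proof.
elim: n g b => [|n IHn] g b g0 mg gb.
  under eq_integral do rewrite big_ord0.
  rewrite big_ord0 [LHS](_ : _ =
    (\int[dirac ([tuple] : Rn R 0)]_t (cst 1%E) t)%E)//.
  by rewrite integral_dirac// diracT mul1e.
pose F (t : Rn R n.+1) := \prod_i g i (tnth t i).
rewrite [LHS](_ : _ = (\int[pushforward
    (sf_product (@lebesgue_measure R) (lebesgueRn R n)) (@consRn R n)]_t
    (F t)%:E)%E)//.
rewrite ge0_integral_pushforward//=; last 3 first.
- exact: measurable_consRn.
- by apply/measurable_EFinP; exact: measurable_prod_tnth.
- by move=> t _; rewrite lee_fin prodr_ge0.
under eq_integral => p _.
  rewrite /F big_ord_recl tnth0.
  under eq_bigr => i _ do rewrite tnthS.
  over.
rewrite big_ord_recl; apply: (integral_sf_product_tensor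
  (g := fun t : Rn R n => \prod_i g (lift ord0 i) (tnth t i))) => //.
- by move=> t; rewrite prodr_ge0.
- exact: (mg ord0).
- exact: (measurable_prod_tnth (fun i => mg (lift ord0 i))).
- exact: (IHn (fun i => g (lift ord0 i)) (fun i => b (lift ord0 i))).
Qed.

(** The normal density of mean [c] and deviation 1 has mass 1, and its peak value is the inverse of
    the claimed constant. *)
Lemma integral_gaussian (R : realType) (c : R) :
  (\int[@lebesgue_measure R]_x (expR (- (x - c) ^+ 2 / 2))%:E
    = (@Num.sqrt R (pi *+ 2))%:E)%E.
Proof.
have p0 : normal_peak 1 != 0 :> R by rewrite gt_eqF// normal_peak_gt0// oner_eq0.
rewrite -[Num.sqrt _](mulr1 _) EFinM -(integral_normal_pdf c 1).
have <- : (normal_peak 1)^-1 = Num.sqrt (pi *+ 2) :> R.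
  by rewrite /normal_peak invrK expr1n mul1r.
rewrite -ge0_integralZl//; last 3 first.
- by apply/measurable_EFinP; exact: measurable_normal_pdf.
- by move=> x _; rewrite lee_fin normal_pdf_ge0.
- by rewrite lee_fin invr_ge0 normal_peak_ge0.
apply: eq_integral => x _.
rewrite normal_pdfE ?oner_eq0// -EFinM mulrA mulVf// mul1r.
by rewrite /normal_fun expr1n.
Qed.

(** * Compact polysquares and exponential growth of moderate weights *)

Lemma continuous_real_complex (R : realType) :
  continuous ((fun x => x%:C) : R -> (R[i])^o).
Proof.
move=> x; apply/cvgrPdist_lt => e e0.
(* In the order of [R[i]], a positive element has zero imaginary part. *)
have [e' e'0 ->] : exists2 e' : R, 0 < e' & e = e'%:C.
  case: e e0 => a b; rewrite ltcE/= => /andP[/eqP -> a0]; by exists a.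
near=> t.
rewrite -rmorphB/= normc_def/= expr0n addr0 sqrtr_sqr ltcR.
near: t.
exact: (@cvgr_dist_lt _ _ _ (nbhs x) _ id x).
Unshelve. all: by end_near. Qed.

Definition unit_square {R : realType} : set R[i]^o :=
  [set x | `|complex.Re x| <= 1 /\ `|complex.Im x| <= 1].

Lemma compact_unit_square (R : realType) : compact (@unit_square R).
Proof.
pose f (p : R * R) : (R[i])^o := p.1%:C + 'i%C * p.2%:C.
have cf : continuous f.
  move=> p; apply: (@cvgD _ (R[i])^o).
    exact: (@continuous_comp _ _ _ fst _ _ cvg_fst (@continuous_real_complex _ _)).
  apply: (@cvgM R[i]); first exact: cvg_cst.
  exact: (@continuous_comp _ _ _ snd _ _ cvg_snd (@continuous_real_complex _ _)).
suff -> : @unit_square R = f @` (`[-1, 1] `*` `[-1, 1]).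
  apply: continuous_compact; first exact: continuous_subspaceT.
  by apply: compact_setX; exact: segment_compact.
apply/seteqP; split => [[x y] [/= x1 y1]|_ [[x y] [/= x1 y1] <-]].
  exists (x, y); rewrite /= ?in_itv/= -?ler_norml//.
  by apply/esym; exact: (complexE (x +i* y)).
move: x1 y1; rewrite !in_itv/= -!ler_norml /unit_square /f /=.
by rewrite !(mul0r,mul1r,addr0,subr0,add0r).
Qed.

Definition unit_polysquare {R : realType} {d} : set (Cn R d) :=
  [set w | forall j, unit_square (w 0 j)].

Lemma compact_unit_polysquare (R : realType) d : compact (@unit_polysquare R d).
Proof. exact: (@rV_compact _ _ (fun=> unit_square) (fun=> @compact_unit_square R)). Qed.

(** This norm is a sum over the real coordinates, so its exponential can be absorbed one real
    variable at a time. *)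
Definition l1norm {R : realType} {d} (w : Cn R d) : R :=
  \sum_j (`|complex.Re (w 0 j)| + `|complex.Im (w 0 j)|).

(** Cut [w] into [n] equal steps lying in the unit polysquare, where [v] is bounded. Each step costs
    a factor [A], and [n] is at most [1 + l1norm w]. *)
Lemma moderate_weight_exp_growth (R : realType) d (omega : Cn R d -> R) :
  moderate_weight omega ->
  exists k : R, forall z w,
    omega (z + w) <= omega z * expR (k * (1 + l1norm w)).
Proof.
move=> [omega_gt0 _ _ [v [C [v_gt0 v_bnd C_ge1 omegaM]]]].
have [M vM] := v_bnd _ (@compact_unit_polysquare R d).
(* The maximum with 1 makes [ln A] nonnegative, so that [n] may be replaced by an upper bound in the
   exponent. *)
pose A := C * Num.max 1 M.
have A_ge1 : 1 <= A by rewrite /A mulr_ege1// le_max lexx.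
have A_gt0 : 0 < A by exact: lt_le_trans A_ge1.
have step z u n : unit_polysquare u -> omega (z + u *+ n) <= omega z * A ^+ n.
  move=> Ku; elim: n => [|n IHn]; first by rewrite mulr0n addr0 expr0 mulr1.
  rewrite mulrSr addrA; apply: (le_trans (omegaM _ _)).
  rewrite exprSr mulrA; apply: (@le_trans _ _ (C * omega (z + u *+ n) * Num.max 1 M)).
    apply: ler_wpM2l.
      by rewrite mulr_ge0//; [exact: le_trans C_ge1|exact: ltW].
    by rewrite le_max (le_trans (ler_norm _) (vM _ Ku)) orbT.
  by rewrite mulrAC -/A mulrC ler_pM2r.
exists (ln A) => z w.
have S0 : 0 <= l1norm w by apply: sumr_ge0 => j _; rewrite addr_ge0.
have S_lt := truncnS_gt (l1norm w).
have le_S := truncn_le (l1norm w); rewrite S0 in le_S.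
(* The successor makes [n] exceed [l1norm w], and keeps it nonzero when [w] is 0. *)
set n := (Num.truncn (l1norm w)).+1 in S_lt.
have n0 : n%:R != 0 :> R by rewrite pnatr_eq0.
have wE : w = ((n%:R^-1)%:C *: w) *+ n.
  rewrite -scaler_nat scalerA -(rmorph_nat (real_complex R)) -rmorphM/=.
  by rewrite mulfV// rmorph1 scale1r.
rewrite {1}wE.
apply: (le_trans (step _ _ _ _)) => [j|].
  have le1 : `|complex.Re (w 0 j)| + `|complex.Im (w 0 j)| <= n%:R.
    apply: ltW; apply: le_lt_trans S_lt.
    by rewrite /l1norm (bigD1 j)//= lerDl sumr_ge0// => i _; rewrite addr_ge0.
  rewrite /unit_square /= mxE.
  case: (w 0 j) le1 => a b /= le1; rewrite !mul0r subr0 addr0.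
  rewrite !normrM normfV normr_nat !ler_pdivrMl ?ltr0Sn// !mulr1.
  by split; apply: le_trans le1; rewrite ?lerDl ?lerDr.
rewrite ler_pM2l// -{1}(lnK A_gt0) -expRM_natl ler_expR mulrC ler_wpM2l ?ln_ge0//.
by rewrite /n -natr1 addrC lerD2l.
Qed.

(** * Complex moduli and the real part of the kernel exponent *)

Lemma CabsM (R : realType) (x y : R[i]) : Cabs (x * y) = Cabs x * Cabs y.
Proof. exact: ComplexField.Normc.normcM. Qed.

Lemma sqr_Cabs (R : realType) (x : R[i]) :
  Cabs x ^+ 2 = complex.Re x ^+ 2 + complex.Im x ^+ 2.
Proof. by case: x => a b; rewrite /Cabs/= sqr_sqrtr// addr_ge0 ?sqr_ge0. Qed.

Lemma Cabs_ge0 (R : realType) (x : R[i]) : 0 <= Cabs x.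
Proof. by case: x => a b; exact: sqrtr_ge0. Qed.

Lemma Cabs_real (R : realType) (x : R) : Cabs x%:C = `|x|.
Proof. by rewrite /Cabs/= expr0n addr0 sqrtr_sqr. Qed.

Lemma normr_Re_le_Cabs (R : realType) (x : R[i]) : `|complex.Re x| <= Cabs x.
Proof.
rewrite -(ler_pXn2r (ltn0Sn 1)) ?nnegrE ?Cabs_ge0// real_normK ?num_real//.
by rewrite sqr_Cabs lerDl sqr_ge0.
Qed.

Lemma normr_Im_le_Cabs (R : realType) (x : R[i]) : `|complex.Im x| <= Cabs x.
Proof.
rewrite -(ler_pXn2r (ltn0Sn 1)) ?nnegrE ?Cabs_ge0// real_normK ?num_real//.
by rewrite sqr_Cabs lerDr sqr_ge0.
Qed.

Lemma Cabs_le_ReIm (R : realType) (x : R[i]) :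
  Cabs x <= `|complex.Re x| + `|complex.Im x|.
Proof.
rewrite -(ler_pXn2r (ltn0Sn 1)) ?nnegrE ?Cabs_ge0 ?addr_ge0//.
rewrite sqr_Cabs sqrrD !real_normK ?num_real// lerD2r lerDl.
by rewrite mulrn_wge0 ?mulr_ge0.
Qed.

Lemma Cabs_Cexp (R : realType) (x : R[i]) : Cabs (Cexp x) = expR (complex.Re x).
Proof.
rewrite /Cexp CabsM Cabs_real ger0_norm ?expR_ge0//.
by rewrite /Cabs/= cos2Dsin2 sqrtr1 mulr1.
Qed.

(** In each real coordinate, [(a - x) * (a' - x) = (x - (a + a') / 2) ^+ 2 - (a - a') ^+ 2 / 4]. *)
Lemma Re_dotC_midpoint (R : realType) d (z w : Cn R d) (p : Rn R d * Rn R d) :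
  complex.Re (dotC (z - toCn p) (w - toCn p)) =
  \sum_j ((tnth p.1 j - complex.Re ((z + w) 0 j) / 2) ^+ 2 +
          (tnth p.2 j - complex.Im ((z + w) 0 j) / 2) ^+ 2) -
  4^-1 * enorm (z - w) ^+ 2.
Proof.
rewrite /dotC /enorm sqr_sqrtr; last by apply: sumr_ge0 => j _; rewrite sqr_ge0.
rewrite raddf_sum/= mulr_sumr -sumrB; apply: eq_bigr => j _.
rewrite sqr_Cabs !mxE; case: (z 0 j) (w 0 j) => a b [a' b'] /=.
by field.
Qed.

(** * The Gaussian majorant and its integral *)

Definition gaussian {R : realType} (c x : R) : R := expR (- (x - c) ^+ 2 / 2).

(** The centre is [c / 2], because [c] will be the sum [z + w]. *)
Definition gaussianCn {R : realType} {d} (c : Cn R d)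
    (p : (Rn R d * Rn R d)%type) : R :=
  (\prod_j gaussian (complex.Re (c 0 j) / 2) (tnth p.1 j)) *
  \prod_j gaussian (complex.Im (c 0 j) / 2) (tnth p.2 j).

Lemma gaussian_absorbs_linear (R : realType) (k s t : R) :
  k * `|2 * (t - s)| - (t - s) ^+ 2 <= 2 * k ^+ 2 - (t - s) ^+ 2 / 2.
Proof.
rewrite normrM (ger0_norm (ler0n _ 2)).
have := sqr_ge0 (`|t - s| - 2 * k); have := real_normK (num_real (t - s)).
by move=> <- h; nra.
Qed.

Lemma expR_weight_gaussian (R : realType) d (k : R) (z w : Cn R d)
    (p : Rn R d * Rn R d) :
  expR (k * (1 + l1norm (2 *: toCn p - (z + w)))) *
  expR (- complex.Re (dotC (z - toCn p) (w - toCn p))) <=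
  expR (k + 4 * k ^+ 2 *+ d) *
  (expR (4^-1 * enorm (z - w) ^+ 2) * gaussianCn (z + w) p).
Proof.
rewrite /gaussianCn -!expR_sum -!expRD ler_expR Re_dotC_midpoint.
rewrite -big_split/= mulrDr mulr1 opprB -!addrA lerD2l.
rewrite [leRHS]addrCA [leLHS]addrCA lerD2l.
(* Each complex coordinate consists of two real ones, and absorbing the linear term costs
   [2 * k ^+ 2] in each. *)
have -> : 4 * k ^+ 2 *+ d = \sum_(j < d) 4 * k ^+ 2.
  by rewrite sumr_const card_ord.
rewrite /l1norm mulr_sumr -sumrB -big_split/=.
apply: ler_sum => j _.
have -> : complex.Re ((2 *: toCn p - (z + w)) 0 j) =
    2 * (tnth p.1 j - complex.Re ((z + w) 0 j) / 2).
  rewrite !mxE; case: (z 0 j) (w 0 j) => a b [a' b'] /=; by field.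
have -> : complex.Im ((2 *: toCn p - (z + w)) 0 j) =
    2 * (tnth p.2 j - complex.Im ((z + w) 0 j) / 2).
  rewrite !mxE; case: (z 0 j) (w 0 j) => a b [a' b'] /=; by field.
have := gaussian_absorbs_linear k (complex.Re ((z + w) 0 j) / 2) (tnth p.1 j).
have := gaussian_absorbs_linear k (complex.Im ((z + w) 0 j) / 2) (tnth p.2 j).
lra.
Qed.

Lemma measurable_gaussian (R : realType) (c : R) :
  measurable_fun setT (gaussian c).
Proof.
rewrite (_ : gaussian c = normal_fun c 1); first exact: measurable_normal_fun.
by apply/funext => x; rewrite /gaussian /normal_fun expr1n.
Qed.

Lemma gaussian_ge0 (R : realType) (c x : R) : 0 <= gaussian c x.
Proof. exact: expR_ge0. Qed.

Lemma measurable_gaussianCn (R : realType) d (c : Cn R d) :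
  measurable_fun setT (gaussianCn c).
Proof.
pose h (u : 'I_d -> R) (t : Rn R d) := \prod_j gaussian (u j) (tnth t j).
have mh u : measurable_fun setT (h u).
  exact: (measurable_prod_tnth (fun j => measurable_gaussian _)).
rewrite (_ : gaussianCn c =
  (h (fun j => complex.Re (c 0 j) / 2) \o fst) \*
  (h (fun j => complex.Im (c 0 j) / 2) \o snd)); last by [].
apply: measurable_funM.
  by apply: (measurableT_comp (mh _)); exact: measurable_fst.
by apply: (measurableT_comp (mh _)); exact: measurable_snd.
Qed.

Lemma gaussianCn_ge0 (R : realType) d (c : Cn R d) p : 0 <= gaussianCn c p.
Proof. by rewrite mulr_ge0// prodr_ge0// => j _; exact: gaussian_ge0. Qed.

(** The value is free of [c], which makes the final constant uniform in [z] and [w]. *)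
Lemma integral_gaussianCn (R : realType) d (c : Cn R d) :
  (\int[lambdaC]_p (gaussianCn c p)%:E =
    (@Num.sqrt R (pi *+ 2) ^+ d * Num.sqrt (pi *+ 2) ^+ d)%:E)%E.
Proof.
have int_prod (u : 'I_d -> R) :
    (\int[lebesgueRn R d]_t (\prod_j gaussian (u j) (tnth t j))%:E =
      (@Num.sqrt R (pi *+ 2) ^+ d)%:E)%E.
  rewrite (integral_lebesgueRn_prod (g := fun j => gaussian (u j))
    (b := fun=> Num.sqrt (pi *+ 2))).
  - by rewrite prodr_const card_ord.
  - by move=> *; exact: gaussian_ge0.
  - by move=> j; exact: measurable_gaussian.
  - by move=> j; exact: integral_gaussian.
apply: integral_sf_product_tensor (int_prod _) (int_prod _).
- by move=> t; rewrite prodr_ge0// => j _; exact: gaussian_ge0.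
- by move=> t; rewrite prodr_ge0// => j _; exact: gaussian_ge0.
- exact: (measurable_prod_tnth (fun j => measurable_gaussian _)).
- exact: (measurable_prod_tnth (fun j => measurable_gaussian _)).
Qed.

(* a0 is an almost-everywhere class (L^1_loc), so the bound on a0 is assumed
   almost everywhere; omega and a0aw are genuine functions. *)
Theorem theorem4p13 (R : realType) (d : nat)
    (a0 : Cn R d -> R[i]) (a0aw : Cn R d -> Cn R d -> R[i])
    (omega : Cn R d -> R) :
  L0A a0 ->
  hatA a0aw ->
  (forall z w : Cn R d,
     a0aw z w = (pi ^- d : R)%:C *
       Cintegral (fun w1 => a0 w1 * Cexp (- dotC (z - w1) (w - w1)))) ->
  moderate_weight omega ->
  (exists C : R,
     {ae lambdaC, forall p, Cabs (a0 (toCn p)) <= C * omega (2 *: toCn p)}) ->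
  exists C : R, forall z w : Cn R d,
    Cabs (a0aw z w) <= C * (expR (4^-1 * enorm (z - w) ^+ 2) * omega (z + w)).
Proof.
move=> _ _ a0awE /[dup] [[omega_gt0 _ _ _]].
move=> /moderate_weight_exp_growth[k omega_growth] [C a0_le].
(* The sign of [C] is unknown, hence the absolute value. *)
pose A := `|C| * expR (k + 4 * k ^+ 2 *+ d).
pose G : R := Num.sqrt (pi *+ 2) ^+ d * Num.sqrt (pi *+ 2) ^+ d.
(* The factor 2 comes from bounding the real and imaginary parts of the integral separately. *)
exists (`|pi ^- d| * ((A * G) *+ 2)) => z w.
set E := expR _ * omega _.
have omega_ge0 u : 0 <= omega u.
  exact/ltW.
have AE_ge0 : 0 <= A * E.
  by rewrite !mulr_ge0 ?expR_ge0 ?normr_ge0.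
rewrite a0awE CabsM Cabs_real -mulrA ler_wpM2l//.
set F := fun w1 : Cn R d => _.
have F_le : {ae lambdaC, forall p, Cabs (F (toCn p)) <= A * E * gaussianCn (z + w) p}.
  apply: filterS a0_le => p a0p; rewrite /F CabsM Cabs_Cexp.
  apply: (@le_trans _ _ (`|C| * omega (2 *: toCn p) *
      expR (complex.Re (- dotC (z - toCn p) (w - toCn p))))).
    apply: ler_wpM2r; first exact: expR_ge0.
    by apply: le_trans a0p _; rewrite ler_wpM2r// ler_norm.
  (* The increment is chosen so that base point plus increment is [2 *: toCn p]. *)
  have := omega_growth (z + w) (2 *: toCn p - (z + w)).
  rewrite addrC subrK => om.
  have := expR_weight_gaussian k z w p.
  rewrite raddfN/=; set g := gaussianCn _ _; set e := expR (- _); move=> eg.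
  rewrite /A /E -!mulrA ler_wpM2l//.
  apply: (@le_trans _ _ (omega (z + w) * (expR (k * (1 + l1norm (2 *: toCn p - (z + w)))) * e))).
    by rewrite mulrA ler_wpM2r// expR_ge0.
  apply: (le_trans (ler_wpM2l _ eg)) => //.
  by rewrite le_eqVlt; apply/orP; left; apply/eqP; ring.
(* Stated for a general [f] so as to serve for both the real and the imaginary part. *)
have int_le (f : R[i] -> R) : (forall x, `|f x| <= Cabs x) ->
    `|\int[lambdaC]_p f (F (toCn p))| <= A * E * G.
  move=> f_le; apply: (@normr_Rintegral_le_dominated _ _ _ _ _
      (fun p => (A * E * gaussianCn (z + w) p)%:E)).
  - by move=> p; rewrite lee_fin mulr_ge0// gaussianCn_ge0.
  - apply/measurable_EFinP; apply: measurable_funM => //.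
    exact: measurable_gaussianCn.
  - by apply: filterS F_le => p; rewrite lee_fin; exact: le_trans (f_le _).
  under eq_integral do rewrite EFinM.
  rewrite ge0_integralZl//.
  - by rewrite integral_gaussianCn -EFinM.
  - by apply/measurable_EFinP; exact: measurable_gaussianCn.
  - by move=> p _; rewrite lee_fin gaussianCn_ge0.
apply: (le_trans (Cabs_le_ReIm _)) => /=.
apply: (le_trans (lerD (int_le _ (@normr_Re_le_Cabs R)) (int_le _ (@normr_Im_le_Cabs R)))).
by rewrite le_eqVlt; apply/orP; left; apply/eqP; ring.
Qed.
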